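(* Let $n\in\mathbb{N}$, $T>0$, $\mu>0$, $\sigma>0$, let $x_0^j\in\mathbb{R}$, $\delta_j>0$, $\theta_j\in[0,1]$ for $j=1,\dots,n$, and let $g:\mathbb{R}\to\mathbb{R}$ be strictly increasing and continuous with $g(0)=0$. Fix $i\in\{1,\dots,n\}$ and let the strategies $\pi^j\in\mathbb{R}$, $j\neq i$, of the other agents be deterministic constants. Consider the problem of agent $i$ $$\sup_{\pi^i\in\mathcal{A}}\ \mathbb{E}\Big[-\exp\Big(-\tfrac{1}{\delta_i}\Big(X_T^{i,\pi^i}-\tfrac{\theta_i}{n}\sum_{j\neq i}X_T^{j,\pi^j}\Big)\Big)\Big],$$ where, for $k=1,\dots,n$, $$X_T^{k,\pi^k}=x_0^k+\int_0^T\pi^k_t\big((\mu+g(\bar\pi_t))\,\mathrm{d}t+\sigma\,\mathrm{d}W_t\big),\qquad \bar\pi_t=\frac1n\sum_{j=1}^n\pi^j_t .$$ If $\lim_{x\to\pm\infty}\frac{g(x)}{x}=\infty$, then this problem does not have an optimal solution, i.e. no $\pi^i\in\mathcal{A}$ attains the supremum.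
   Context: $(\Omega,\mathcal{F},(\mathcal{F}_t)_{t\in[0,T]},\mathbb{P})$ is a filtered probability space carrying a standard Brownian motion $W$. The set of admissible strategies $\mathcal{A}$ consists of all $(\mathcal{F}_t)_{t\in[0,T]}$-progressively measurable processes $\pi:\Omega\times[0,T]\to\mathbb{R}$ with $\int_0^T\pi_t^2\,\mathrm{d}t<\infty$ $\mathbb{P}$-a.s.; $\pi^k_t$ is the amount of money agent $k$ invests in the stock at time $t$. The stock price satisfies $\mathrm{d}S_t=S_t((\mu+g(\bar\pi_t))\,\mathrm{d}t+\sigma\,\mathrm{d}W_t)$, $S_0=1$, and the riskless bond is identically $1$. *)

(* Defs.v *)
From HB Require Import structures.
From mathcomp Require Import all_boot all_order all_algebra.
From mathcomp Require Import all_classical all_reals all_analysis.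

Set Implicit Arguments.
Unset Strict Implicit.
Unset Printing Implicit Defensive.

Import Order.TTheory GRing.Theory Num.Theory.
Import numFieldNormedType.Exports.

Local Open Scope classical_set_scope.
Local Open Scope ring_scope.

(** A real-valued process is a function [R -> Omega -> R]; only its values at
    times in [`[0, T]] are ever used.  A filtration is a function
    [R -> set (set Omega)], again used on [`[0, T]] only. *)

Section FilteredSpace.
Context {R : realType} {d : measure_display} {Omega : measurableType d}.
Variables (P : probability Omega R) (T : R) (F : R -> set (set Omega)).

Definition is_filtration : Prop :=
  [/\ forall t, 0 <= t <= T -> sigma_algebra setT (F t),
      forall t, 0 <= t <= T -> F t `<=` measurable &
      forall s t, 0 <= s -> s <= t -> t <= T -> F s `<=` F t].

Definition adapted_at (t : R) (X : Omega -> R) : Prop :=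
  measurable_fun setT (X : g_sigma_algebraType (F t) -> R).

(** The second argument of [normal_prob] is the standard deviation. *)
Definition is_brownian_motion (W : R -> Omega -> R) : Prop :=
  [/\ forall t, 0 <= t <= T -> adapted_at t (W t),
      {ae P, forall w, W 0 w = 0},
      {ae P, forall w, {within `[0, T], continuous (fun t => W t w)}},
      forall s t, 0 <= s -> s < t -> t <= T ->
        forall B : set R, measurable B ->
          P ((W t \- W s) @^-1` B) = normal_prob 0 (Num.sqrt (t - s)) B &
      forall s t, 0 <= s -> s < t -> t <= T ->
        forall (A : set Omega) (B : set R), F s A -> measurable B ->
          P (A `&` (W t \- W s)%R @^-1` B) =
            (P A * P ((W t \- W s)%R @^-1` B))%E].

Definition progressively_measurable (pi : R -> Omega -> R) : Prop :=
  forall t, 0 <= t <= T ->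
    measurable_fun (setT `*` `[0, t])
      (fun x : g_sigma_algebraType (F t) * R => pi x.2 x.1).

Definition admissible (pi : R -> Omega -> R) : Prop :=
  progressively_measurable pi /\
  {ae P, forall w,
    (\int[lebesgue_measure]_(t in `[0%R, T]) ((pi t w) ^+ 2)%:E < +oo)%E}.

(** The process [\sum_(k < m) xi_k 1_(]t_k, t_(k+1)]], with bounded
    [F (t_k)]-measurable coefficients [xi_k]. *)
Record simple_process := SimpleProcess {
  sp_size : nat;
  sp_time : nat -> R;
  sp_coef : nat -> Omega -> R;
  sp_time_range : forall k, (k <= sp_size)%N -> 0 <= sp_time k <= T;
  sp_time_homo : forall k, (k < sp_size)%N -> sp_time k <= sp_time k.+1;
  sp_coef_adapted : forall k, (k < sp_size)%N ->
    adapted_at (sp_time k) (sp_coef k);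
  sp_coef_bounded : exists M : R, forall k w, (k < sp_size)%N ->
    `|sp_coef k w| <= M }.

Definition simple_eval (H : simple_process) (t : R) (w : Omega) : R :=
  \sum_(k < sp_size H)
    sp_coef H k w * \1_(`]sp_time H k, sp_time H k.+1]) t.

Definition simple_integral (W : R -> Omega -> R) (H : simple_process)
    (w : Omega) : R :=
  \sum_(k < sp_size H)
    sp_coef H k w * (W (sp_time H k.+1) w - W (sp_time H k) w).

Definition cvg_to0_in_probability (Y : nat -> Omega -> \bar R) : Prop :=
  forall e : R, 0 < e ->
    P [set w | (e%:E <= `|Y m w|)%E] @[m --> \oo] --> 0%E.

(** [I] is (a version of) the Ito integral of [pi] against [W] over
    [`[0, T]]: the limit in probability of the integrals of simple processes
    [H_m] for which [\int_0^T (H_m - pi)^2 dt] tends to [0] in probability.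
    For a Brownian motion [W] and an admissible [pi] such [H_m] exist, and the
    limit does not depend on them, so [I] exists and is almost surely unique;
    it is therefore given as a relation. *)
Definition is_ito_integral (W pi : R -> Omega -> R) (I : Omega -> R) : Prop :=
  measurable_fun setT I /\
  exists H : nat -> simple_process,
    cvg_to0_in_probability (fun m w =>
      \int[lebesgue_measure]_(t in `[0%R, T])
        ((simple_eval (H m) t w - pi t w) ^+ 2)%:E)%E /\
    cvg_to0_in_probability (fun m w => (simple_integral W (H m) w - I w)%:E).

End FilteredSpace.

Section Agents.
Context {R : realType} {d : measure_display} {Omega : measurableType d}.
Variables (P : probability Omega R) (T : R) (F : R -> set (set Omega)).
Variables (W : R -> Omega -> R) (mu sigma : R) (g : R -> R) (n : nat).

Definition mean_strategy (pi : 'I_n -> R -> Omega -> R) (t : R) (w : Omega)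
  : R := n%:R^-1 * \sum_(j < n) pi j t w.

(** [X] is a version of the terminal wealth
    [x0 + \int_0^T pi_k ((mu + g (mean pi)) dt + sigma dW)].
    As for any Ito process, the drift must be almost surely integrable on
    [`[0, T]].  Square integrability of [pi_k] does not imply this when [g] is
    superlinear. *)
Definition is_terminal_wealth (pi : 'I_n -> R -> Omega -> R) (x0 : R)
    (k : 'I_n) (X : Omega -> R) : Prop :=
  let drift w t := pi k t w * (mu + g (mean_strategy pi t w)) in
  [/\ measurable_fun setT X,
      {ae P, forall w,
        lebesgue_measure.-integrable `[0, T] (EFin \o drift w)} &
      exists2 I : Omega -> R, is_ito_integral P T F W (pi k) I &
        {ae P, forall w,
          X w = x0 + (\int[lebesgue_measure]_(t in `[0, T]) drift w t)
                + sigma * I w}].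

(** Agent [i] plays [pi] and every other agent [j] the constant [c j]; the
    value [c i] is not used. *)
Definition against_constants (i : 'I_n) (c : 'I_n -> R) (pi : R -> Omega -> R)
  : 'I_n -> R -> Omega -> R :=
  fun j => if j == i then pi else fun _ _ => c j.

Definition relative_utility (delta theta : 'I_n -> R) (i : 'I_n)
    (X : 'I_n -> Omega -> R) (w : Omega) : R :=
  - expR (- (delta i)^-1 *
            (X i w - theta i / n%:R * \sum_(j < n | j != i) X j w)).

(** [v] is agent [i]'s expected utility when she plays [pi].  It is
    [\bar R]-valued ([-oo] is possible), and independent of the versions [X k]
    of the terminal wealths. *)
Definition has_expected_utility (x0 delta theta c : 'I_n -> R) (i : 'I_n)
    (pi : R -> Omega -> R) (v : \bar R) : Prop :=
  exists2 X : 'I_n -> Omega -> R,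
    forall k, is_terminal_wealth (against_constants i c pi) (x0 k) k (X k) &
    v = 'E_P[relative_utility delta theta i X]%E.

Definition optimal_value (x0 delta theta c : 'I_n -> R) (i : 'I_n) : \bar R :=
  ereal_sup [set v | exists2 pi, admissible P T F pi &
                       has_expected_utility x0 delta theta c i pi v].

Definition is_optimal (x0 delta theta c : 'I_n -> R) (i : 'I_n)
    (pi : R -> Omega -> R) : Prop :=
  admissible P T F pi /\
  has_expected_utility x0 delta theta c i pi
    (optimal_value x0 delta theta c i).

End Agents.

(* Main.v *)
Require Import Defs.
From HB Require Import structures.
From mathcomp Require Import all_boot all_order all_algebra.
From mathcomp Require Import all_classical all_reals all_analysis.
From mathcomp Require Import measurable_realfun ring lra.
Import Order.TTheory GRing.Theory Num.Theory.
Import numFieldNormedType.Exports.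
Local Open Scope classical_set_scope.
Local Open Scope ring_scope.

(** A constant strategy [C + q], where [C] is the agent's benchmark exposure to
    the stock, gives a Gaussian relative wealth and hence expected utility
    [- exp (- (K + q (mu + g m) T) / delta + (sigma q / delta)^2 T / 2)].
    As the mean position [m] is affine in [q] with positive slope, superlinearity of [g] at
    [+oo] makes the drift term [q g] dominate the quadratic variance term, so
    the supremum is at least [0].  It is not attained, because the utility is
    negative everywhere. *)

(** * Integration against a measure given by a density *)

Section Density.
Import HBNNSimple.
Context {d : measure_display} {S : measurableType d} {R : realType}.
Variables (mu nu : {measure set S -> \bar R}) (h : S -> R).
Hypotheses (mh : measurable_fun setT h) (h0 : forall x, 0 <= h x).
Hypothesis nuE :
  forall A, measurable A -> (nu A = \int[mu]_(x in A) (h x)%:E)%E.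
Local Open Scope ereal_scope.

(** A simple function is a finite sum of values times indicators of its level sets, and on each
    level set the claim is [nuE]. *)
Let integral_density_nnsfun (f : {nnsfun S >-> R}) :
  \int[nu]_x (f x)%:E = \int[mu]_x ((f x)%:E * (h x)%:E).
Proof.
rewrite integralT_nnsfun sintegralE.
under [RHS]eq_integral => x _.
  rewrite fimfunE -fsumEFin// muleC ge0_mule_fsumr; last first.
    by move=> r; rewrite EFinM nnfun_muleindic_ge0.
  over.
rewrite [RHS]ge0_integral_fsum//; last 2 first.
  - move=> r; apply: emeasurable_funM; first exact/measurable_EFinP.
    exact/measurable_EFinP/measurableT_comp.
  - move=> n x _.
    by apply: mule_ge0; [rewrite lee_fin|rewrite EFinM nnfun_muleindic_ge0].
apply: eq_fsbigr => r; rewrite inE => -[t _ <-].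
rewrite nuE// integral_mkcond -ge0_integralZl//=.
- apply: eq_integral => x _; rewrite patchE indicE.
  by case: (x \in _); rewrite /= ?mulr1 ?mulr0 ?mule0// muleC.
- apply/(measurable_restrictT _ _).1 => //; exact/measurable_EFinP/measurable_funTS.
- by move=> x _; rewrite patchE; case: ifP; rewrite // lee_fin.
- by rewrite lee_fin.
Qed.

(** Both sides are limits of integrals of the same increasing simple functions, by monotone
    convergence under [nu] and, as [h] is nonnegative, under [mu]. *)
Lemma ge0_integral_density (f : S -> \bar R) :
  measurable_fun setT f -> (forall x, 0 <= f x) ->
  \int[nu]_x f x = \int[mu]_x (f x * (h x)%:E).
Proof.
move=> mf f0; pose f_ := nnsfun_approx measurableT mf.
have cvf x : (f_ n x)%:E @[n --> \oo] --> f x by exact: cvg_nnsfun_approx.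
have ndf x m n : (m <= n)%N -> (f_ m x <= f_ n x)%R.
  by move=> mn; exact/lefP/nd_nnsfun_approx.
transitivity (limn (fun n => \int[nu]_x (f_ n x)%:E)).
  rewrite -monotone_convergence//=.
  - by apply: eq_integral => x _; exact/esym/cvg_lim.
  - by move=> n; exact/measurable_EFinP/measurable_funTS.
  - by move=> n x _; rewrite lee_fin.
  - by move=> x _ m n mn; rewrite lee_fin ndf.
under eq_fun do rewrite integral_density_nnsfun.
rewrite -monotone_convergence//=.
- apply: eq_integral => x _; apply: cvg_lim => //.
  by apply: cvgeZr => //; exact: cvf.
- by move=> n; apply: emeasurable_funM => //; exact/measurable_EFinP.
- by move=> n x _; rewrite mule_ge0// lee_fin.
- by move=> x _ m n mn; rewrite lee_wpmul2r ?lee_fin ?ndf.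
Qed.

End Density.

(** * Gaussian exponential moments and auxiliary estimates *)

Lemma normal_pdf_tilt {R : realType} (m s b x : R) : s != 0 ->
  expR (b * x) * normal_pdf m s x =
  expR (b * m + (b * s) ^+ 2 / 2) * normal_pdf (m + b * s ^+ 2) s x.
Proof.
move=> s0; rewrite /normal_pdf (negbTE s0) /normal_fun.
(* Completing the square: the exponential factor only shifts the mean by [b * s ^+ 2]. *)
rewrite mulrCA [RHS]mulrCA -!expRD; congr (_ * expR _); field.
by rewrite s0.
Qed.

Lemma measurable_expRM {R : realType} (b : R) :
  measurable_fun [set: R] (fun x => expR (b * x)).
Proof. by apply: measurableT_comp => //; exact: measurable_funM. Qed.

(** After tilting, a constant multiplies a normal density, whose integral is 1. Taking any measure
    [nu] that agrees with the normal law lets this apply to the law of a Brownian increment. *)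
Lemma normal_mgf {R : realType} (nu : {measure set (measurableTypeR R) -> \bar R})
    (m s b : R) :
  s != 0 ->
  (forall B, measurable B -> nu B = normal_prob m s B) ->
  (\int[nu]_x (expR (b * x))%:E = (expR (b * m + (b * s) ^+ 2 / 2))%:E)%E.
Proof.
move=> s0 nuE.
rewrite (@ge0_integral_density _ (measurableTypeR R) R lebesgue_measure nu
  (normal_pdf m s))//.
- under eq_integral do rewrite -EFinM normal_pdf_tilt// EFinM.
  rewrite ge0_integralZl//=.
  + by rewrite integral_normal_pdf mule1.
  + by apply/measurable_EFinP; exact: measurable_normal_pdf.
  + by move=> x _; rewrite lee_fin normal_pdf_ge0.
- exact: measurable_normal_pdf.
- by move=> x; exact: normal_pdf_ge0.
- by apply/measurable_EFinP; exact: measurable_expRM.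
Qed.

(** A zero integral would make the exponential vanish almost everywhere; as it vanishes nowhere, the
    whole space would be null, against [P setT = 1]. The integral may be infinite. *)
Lemma integral_expR_gt0 {d} {S : measurableType d} {R : realType}
    (P : probability S R) (Y : S -> R) : measurable_fun setT Y ->
  (0 < \int[P]_w (expR (Y w))%:E)%E.
Proof.
move=> mY; rewrite lt_neqAle integral_ge0 ?andbT//.
apply/eqP => /esym I0.
have [] := (ae_eq_integral_abs P measurableT
  (f := fun w => (expR (Y w))%:E) _).1.
- by apply/measurable_EFinP; exact: measurableT_comp.
- by rewrite -[RHS]I0; apply: eq_integral => w _; rewrite gee0_abs// lee_fin expR_ge0.
move=> N [mN N0 subN]; have NT : N = setT.
  apply/seteqP; split => // w _; apply: subN => /= /(_ I) /eqP.
  by rewrite eqe gt_eqF// expR_gt0.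
have PN : P N = 1%E by rewrite NT probability_setT.
by have /eqP := etrans (esym PN) N0; rewrite onee_eq0.
Qed.

Lemma superlinear_beats_quadratic {R : realType} (g : R -> R) (a b k M : R) :
  g x / x @[x --> +oo] --> +oo -> 0 < a ->
  exists2 q : R, 0 < q & k * q ^+ 2 + M <= q * g (a * q + b).
Proof.
move=> /cvgryPge gy a0.
(* With this slope, any y above [A] with y >= a q / 2 has g(y) >= (|k| + 1) q; the extra q is what
   absorbs [M]. *)
have [A [_ hA]] := gy (2 * (`|k| + 1) / a).
(* The first two terms give q^2 >= M; the other two make a q + b exceed [A] and be at least a q /
   2. *)
pose q := 1 + `|M| + 2 * `|b| / a + 2 * `|A| / a.
have q1 : 1 + `|M| <= q by rewrite /q -addrA lerDl addr_ge0// divr_ge0// ltW.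
have q0 : 0 < q by rewrite (lt_le_trans _ q1)// ltr_wpDr.
exists q => //.
have aq : a * q = a * (1 + `|M|) + 2 * `|b| + 2 * `|A|.
  by rewrite /q; field; rewrite gt_eqF.
have aM : 0 < a * (1 + `|M|) by rewrite mulr_gt0// ltr_wpDr.
have := ler_norm (- b); rewrite normrN => nb.
have nA := ler_norm A; have b0 := normr_ge0 b; have A0 := normr_ge0 A.
have yA : A < a * q + b by lra.
have yq : a * q / 2 <= a * q + b by lra.
have y0 : 0 < a * q + b by rewrite (lt_le_trans _ yq)// divr_gt0// mulr_gt0.
have := hA _ yA; rewrite ler_pdivlMr// => gge.
have k1 : 0 <= `|k| + 1 by rewrite addr_ge0.
have : (`|k| + 1) * q <= g (a * q + b).
  apply: le_trans gge; rewrite -[leLHS](_ : 2 * (`|k| + 1) / a * (a * q / 2) = _).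
    by rewrite ler_wpM2l// divr_ge0 ?mulr_ge0// ltW.
  by field; rewrite gt_eqF.
rewrite -(ler_pM2l q0) => /(le_trans _); apply.
have := ler_norm k; have := ler_norm M; have := normr_ge0 M => M0 nM nk.
have : k * q ^+ 2 <= `|k| * q ^+ 2 by rewrite ler_wpM2r// sqr_ge0.
have : M <= q ^+ 2 by nra.
lra.
Qed.

(** * Stochastic integral, wealth and exponential moment for constant strategies *)

Section ConstantStrategies.
Context {R : realType} {d : measure_display} {Omega : measurableType d}.
Variables (P : probability Omega R) (T : R) (F : R -> set (set Omega)).
Variables (W : R -> Omega -> R).
Hypotheses (T_gt0 : 0 < T) (filtF : is_filtration T F).

Lemma adapted_at_measurable (t : R) (X : Omega -> R) : 0 <= t <= T ->
  adapted_at F t X -> measurable_fun setT X.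
Proof.
move=> tT mX _ B mB; have [sF Fm _] := filtF.
have := mX measurableT B mB; rewrite !setTI.
by apply: smallest_sub => //; [exact: sigma_algebra_measurable|exact: Fm].
Qed.

Lemma admissible_cst (p : R) : admissible P T F (fun _ _ => p).
Proof.
split; first by move=> t _; exact: measurable_cst.
apply: aeW => w; rewrite integral_cst//= lebesgue_measure_itv/= lte_fin T_gt0.
by rewrite -EFinB -EFinM ltry.
Qed.

Lemma cvg_to0_in_probability_0 (Y : nat -> Omega -> \bar R) :
  (forall m w, Y m w = 0%E) -> cvg_to0_in_probability P Y.
Proof.
move=> Y0 e e0; rewrite (_ : (fun _ => _) = cst 0%E); first exact: cvg_cst.
apply/funext => m /=; rewrite (_ : [set w | _] = set0) ?measure0//.
by apply/seteqP; split => // w /=; rewrite Y0 abse0 lee_fin leNgt e0.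
Qed.

(** Up to its value at time 0, a constant is itself a simple process, on the one-interval grid 0,
    [T]; a constant approximating sequence therefore suffices. *)
Lemma is_ito_integral_cst (p : R) : adapted_at F 0 (W 0) -> adapted_at F T (W T) ->
  is_ito_integral P T F W (fun _ _ => p) (fun w => p * (W T w - W 0 w)).
Proof.
move=> W0 WT; have T0 := ltW T_gt0; split.
  apply: measurable_funM => //; apply: measurable_funB.
    by apply: adapted_at_measurable WT; rewrite T0 lexx.
  by apply: adapted_at_measurable W0; rewrite T0 lexx.
have tr k : (k <= 1)%N -> 0 <= (if k is 0 then 0 else T) <= T.
  by case: k => [|k]; rewrite ?T0 lexx.
have th k : (k < 1)%N ->
    (if k is 0 then 0 else T) <= (if k.+1 is 0 then 0 else T).
  by case: k.
have ca k : (k < 1)%N ->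
    adapted_at F (if k is 0 then 0 else T) (fun _ : Omega => p).
  by move=> _; exact: measurable_cst.
have cb : exists M : R, forall k (w : Omega), (k < 1)%N -> `|p| <= M.
  by exists `|p|.
exists (fun=> SimpleProcess tr th ca cb); split.
- apply: cvg_to0_in_probability_0 => _ w.
  (* The simple process equals [p] on ]0, T] but 0 at time 0; dropping this null point leaves a zero
     integrand. *)
  rewrite -integral_itv_obnd_cbnd.
    apply: integral0_eq => t /= t0T.
    rewrite /simple_eval/= big_ord_recl big_ord0/= addr0 indicE mem_set//=.
    by rewrite mulr1 subrr expr0n.
  apply/measurable_EFinP; apply: measurable_funX; apply: measurable_funB => //.
  rewrite /simple_eval; apply: measurable_sum => k.
  exact: measurable_funM.
- apply: cvg_to0_in_probability_0 => _ w.
  by rewrite /simple_integral/= big_ord_recl big_ord0/= addr0 subrr.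
Qed.

Lemma is_terminal_wealth_cst (mu sigma : R) (g : R -> R) (n : nat)
    (a : 'I_n -> R) (x : R) (k : 'I_n) :
  adapted_at F 0 (W 0) -> adapted_at F T (W T) ->
  is_terminal_wealth P T F W mu sigma g (fun j _ _ => a j) x k
    (fun w => x + a k * (mu + g (n%:R^-1 * \sum_(j < n) a j)) * T
              + sigma * (a k * (W T w - W 0 w))).
Proof.
move=> W0 WT; have T0 := ltW T_gt0; have ito := is_ito_integral_cst (a k) W0 WT.
set K := a k * _; have iK :
    lebesgue_measure.-integrable `[0, T]%classic (fun _ : R => K%:E).
  apply/integrableP; split; first exact: measurable_cst.
  rewrite integral_cst//= lebesgue_measure_itv/= lte_fin T_gt0.
  by rewrite -EFinB -EFinM ltry.
split; first by apply: measurable_funD => //; apply: measurable_funM => //; case: ito.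
- by apply: aeW => w; exact: iK.
- exists (fun w => a k * (W T w - W 0 w)) => //; apply: aeW => w.
  rewrite (_ : Rintegral _ _ _ = K * T)//.
  transitivity (\int[lebesgue_measure]_(t in `[0, T]) K) => //.
  by rewrite Rintegral_cst//= lebesgue_measure_itv/= lte_fin T_gt0 -EFinB subr0.
Qed.

Lemma expected_exp_brownian (u v : R) : is_brownian_motion P T F W ->
  'E_P[(fun w => - expR (u + v * (W T w - W 0 w)))%R]%E =
    (- expR (u + v ^+ 2 * T / 2))%:E.
Proof.
move=> [adW _ _ incW _]; have T0 := ltW T_gt0.
have mX : measurable_fun setT (fun w => W T w - W 0 w : measurableTypeR R).
  apply: measurable_funB.
    by apply: adapted_at_measurable (adW T _); rewrite T0 lexx.
  by apply: adapted_at_measurable (adW 0 _); rewrite T0 lexx.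
(* The expectation is transported to the law of the increment, which is normal with standard
   deviation [Num.sqrt T] by the Brownian property between times 0 and [T]. *)
pose X : {RV P >-> measurableTypeR R} :=
  HB.pack (fun w => W T w - W 0 w : measurableTypeR R)
    (isMeasurableFun.Build _ _ _ _ _ mX).
have mgf := @normal_mgf _ (distribution P X) 0 (Num.sqrt T) v.
rewrite unlock; under eq_integral do rewrite EFinN expRD EFinM.
rewrite integral_ge0N; last by move=> w _; rewrite -EFinM lee_fin mulr_ge0 ?expR_ge0.
have mexp : measurable_fun [set: measurableTypeR R] (fun x => (expR (v * x))%:E).
  by apply/measurable_EFinP; exact: measurable_expRM.
rewrite ge0_integralZl//=; last exact: (measurableT_comp mexp mX).
have <- := ge0_integral_distribution X mexp _.
rewrite mgf ?gt_eqF ?sqrtr_gt0//.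
- by rewrite mulr0 add0r exprMn sqr_sqrtr// -EFinM -expRD.
- by move=> B mB; have := incW 0 T (lexx _) T_gt0 (lexx _) B mB; rewrite subr0.
- by move=> x; rewrite lee_fin expR_ge0.
Qed.

End ConstantStrategies.

(** * Lower bound on the value against constant opponents *)

Section AgainstConstants.
Context {R : realType} {d : measure_display} {Omega : measurableType d}.
Variables (P : probability Omega R) (T : R) (F : R -> set (set Omega)).
Variables (W : R -> Omega -> R) (n : nat) (mu sigma : R).
Variables (x0 delta theta : 'I_n -> R) (g : R -> R) (i : 'I_n) (c : 'I_n -> R).
Hypotheses (T_gt0 : 0 < T) (filtF : is_filtration T F).
Hypotheses (brownW : is_brownian_motion P T F W) (mu_gt0 : 0 < mu).

(** The position that offsets the stock exposure of the benchmark, so that playing [C + q] leaves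
    net exposure [q]. *)
Let C : R := theta i / n%:R * \sum_(j < n | j != i) c j.
Let K : R := x0 i - theta i / n%:R * \sum_(j < n | j != i) x0 j.
(** The stock's drift rate when agent [i] plays [C + q], with the mean position displayed as affine
    in [q], as [superlinear_beats_quadratic] expects. *)
Let D (q : R) : R :=
  mu + g (n%:R^-1 * q + n%:R^-1 * (C + \sum_(j < n | j != i) c j)).

(** All agents earn multiples of the same random return [D q * T + sigma * (W T w - W 0 w)]. In the
    relative wealth the multiple [C] cancels, leaving [K] plus [q] times this return. *)
Lemma has_expected_utility_cst (q : R) :
  has_expected_utility P T F W mu sigma g x0 delta theta c i
    (fun _ _ => C + q)
    (- expR (- (K + q * D q * T) / delta i
             + (sigma * q / delta i) ^+ 2 * T / 2))%:E.
Proof.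
have [adW _ _ _ _] := brownW; have T0 := ltW T_gt0.
have aW0 : adapted_at F 0 (W 0) by apply: adW; rewrite T0 lexx.
have aWT : adapted_at F T (W T) by apply: adW; rewrite T0 lexx.
pose a j : R := if j == i then C + q else c j.
have aE : against_constants i c (fun _ _ => C + q) = (fun j _ (_ : Omega) => a j).
  by apply/funext => j; rewrite /against_constants /a; case: ifP.
have sumA : \sum_(j < n) a j = C + q + \sum_(j < n | j != i) c j.
  rewrite (bigD1 i)//= {1}/a eqxx; congr (_ + _).
  by apply: eq_bigr => j /negbTE ji; rewrite /a ji.
have DE : mu + g (n%:R^-1 * \sum_(j < n) a j) = D q.
  by rewrite sumA /D -mulrDr addrA (addrC q).
exists (fun k w => x0 k + a k * (mu + g (n%:R^-1 * \sum_(j < n) a j)) * T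
              + sigma * (a k * (W T w - W 0 w))).
  by move=> k; rewrite aE; exact: is_terminal_wealth_cst.
(* The increment enters the exponent with the negative coefficient - sigma q / delta_i. *)
rewrite -[(sigma * q / delta i) ^+ 2]sqrrN -(expected_exp_brownian P T F W T_gt0 filtF)//.
congr expectation; apply/funext => w; rewrite /relative_utility DE; congr (- expR _).
have -> : \sum_(j < n | j != i) (x0 j + a j * D q * T + sigma * (a j * (W T w - W 0 w)))
    = \sum_(j < n | j != i) x0 j
      + (\sum_(j < n | j != i) c j) * (D q * T + sigma * (W T w - W 0 w)).
  rewrite mulr_suml -big_split/=; apply: eq_bigr => j /negbTE ji.
  by rewrite /a ji; ring.
rewrite /a eqxx /K /C; ring.
Qed.

Lemma optimal_value_ge0 :
  0 < sigma -> 0 < delta i -> g x / x @[x --> +oo] --> +oo ->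
  (0 <= optimal_value P T F W mu sigma g x0 delta theta c i)%E.
Proof.
move=> s0 d0 gy.
have n0 : 0 < n%:R :> R by rewrite ltr0n (leq_trans _ (ltn_ord i)).
suff H M : ((- expR (- M))%:E <= optimal_value P T F W mu sigma g x0 delta theta c i)%E.
  rewrite leNgt; apply/negP; move: H; case: optimal_value => [r H|//|H _].
  (* For a negative value r, this [M] makes the lower bound r / 2, which exceeds r. *)
  - rewrite lte_fin => r0; have := H (- ln (- r / 2)).
    rewrite opprK lnK ?posrE ?divr_gt0 ?oppr_gt0// lee_fin; lra.
  - by have := H 0.
have n0V : 0 < n%:R^-1 :> R by rewrite invr_gt0.
(* The coefficients come from solving for q D(q) the requirement that the exponent of the expected
   utility be at most -M. *)
have [q q0 hq] := @superlinear_beats_quadratic _ g n%:R^-1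
  (n%:R^-1 * (C + \sum_(j < n | j != i) c j))
  (sigma ^+ 2 / (2 * delta i)) ((delta i * M - K) / T) gy n0V.
apply: (@le_trans _ _ (- expR (- (K + q * D q * T) / delta i
             + (sigma * q / delta i) ^+ 2 * T / 2))%:E); last first.
  apply: ereal_sup_ubound; exists (fun _ _ => C + q); first exact: admissible_cst.
  exact: has_expected_utility_cst.
rewrite lee_fin lerN2 ler_expR -(ler_pM2l d0) -subr_ge0.
rewrite (_ : _ - _ =
  T * (q * D q - (sigma ^+ 2 / (2 * delta i) * q ^+ 2 + (delta i * M - K) / T))).
  (* [hq] bounds q g alone; passing to q D(q) adds q mu, which is positive. *)
  by rewrite mulr_ge0 ?(ltW T_gt0)// subr_ge0 (le_trans hq)// ler_pM2l// lerDr ltW.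
by field; rewrite !gt_eqF.
Qed.

End AgainstConstants.

(** The expected utility is minus the integral of an exponential, which is positive even if
    infinite; the value [-oo] is thus covered too. *)
Lemma has_expected_utility_lt0 {R : realType} {d : measure_display}
    {Omega : measurableType d} (P : probability Omega R) (T : R)
    (F : R -> set (set Omega)) (W : R -> Omega -> R) (n : nat) (mu sigma : R)
    (g : R -> R) (x0 delta theta c : 'I_n -> R) (i : 'I_n)
    (pi : R -> Omega -> R) (v : \bar R) :
  has_expected_utility P T F W mu sigma g x0 delta theta c i pi v -> (v < 0)%E.
Proof.
move=> [X wX ->]; rewrite /relative_utility unlock.
under eq_integral do rewrite EFinN.
rewrite integral_ge0N; last by move=> w _; rewrite lee_fin expR_ge0.
rewrite oppe_lt0; apply: integral_expR_gt0.
have mX k : measurable_fun setT (X k) by have [] := wX k.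
apply: measurable_funM => //; apply: measurable_funB => //.
apply: measurable_funM => //; under eq_fun do rewrite big_mkcond.
by apply: measurable_sum => j; case: (j != i).
Qed.

Theorem proposition4p1 (R : realType) (d : measure_display)
    (Omega : measurableType d) (P : probability Omega R) (T : R)
    (F : R -> set (set Omega)) (W : R -> Omega -> R) (n : nat)
    (mu sigma : R) (x0 delta theta : 'I_n -> R) (g : R -> R)
    (i : 'I_n) (c : 'I_n -> R)
    (T_gt0 : 0 < T)
    (filtF : is_filtration T F)
    (brownW : is_brownian_motion P T F W)
    (mu_gt0 : 0 < mu) (sigma_gt0 : 0 < sigma)
    (delta_gt0 : forall j, 0 < delta j)
    (theta01 : forall j, 0 <= theta j <= 1)
    (g_incr : {homo g : x y / x < y})
    (g_cont : continuous g)
    (g0 : g 0 = 0)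
    (g_pinfty : g x / x @[x --> +oo] --> +oo)
    (g_ninfty : g x / x @[x --> -oo] --> +oo) :
  ~ exists pi : R -> Omega -> R,
      is_optimal P T F W mu sigma g x0 delta theta c i pi.
Proof.
(* An optimal strategy would have the supremum as its own expected utility, forcing the supremum to
   be negative. *)
move=> [pi [_ /has_expected_utility_lt0]]; apply/negP; rewrite -leNgt.
exact: optimal_value_ge0.
Qed.
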